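(* Let $\xi>0$ be such that $D^TD-\xi^2I$ is nonsingular, and let $\lambda\in\mathbb{C}$. Then $$\exists v\in\mathbb{C}^{2n},\ v\neq0:\ H(\lambda,\xi)v=0\quad\Longleftrightarrow\quad\exists u\in X,\ u\neq0:\ (\lambda I-\mathcal{L}_\xi)u=0.$$ Furthermore, if $(\lambda,u)$ with $u\in X$, $u\ne0$, satisfies $(\lambda I-\mathcal{L}_\xi)u=0$, then $u$ has the form $$u(\theta)=ve^{\lambda\theta},\quad\theta\in[-1,1],$$ where $v\in\mathbb{C}^{2n}$, $v\neq 0$, satisfies $H(\lambda,\xi)v=0$. Conversely, if $v\in\mathbb{C}^{2n}$, $v\ne0$, satisfies $H(\lambda,\xi)v=0$, then $u(\theta)=ve^{\lambda\theta}$, $\theta\in[-1,1]$, satisfies $(\lambda I-\mathcal{L}_\xi)u=0$ (and $u\neq 0$).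
   Context: Let $A_0,\dots,A_m\in\mathbb{R}^{n\times n}$, $B\in\mathbb{R}^{n\times n_u}$, $C\in\mathbb{R}^{n_y\times n}$, $D\in\mathbb{R}^{n_y\times n_u}$, and let $\tau_0,\dots,\tau_m\ge0$ with $\max_{0\le i\le m}\tau_i=1$. Put $D_\xi=D^TD-\xi^2I$ and $$M_0=\begin{bmatrix}A_0&-BD_\xi^{-1}B^T\\-C^TC+C^TDD_\xi^{-1}D^TC&-A_0^T\end{bmatrix},\ M_i=\begin{bmatrix}A_i&0\\0&0\end{bmatrix},\ M_{-i}=\begin{bmatrix}0&0\\0&-A_i^T\end{bmatrix}\ (1\le i\le m),$$ $$N_1=\begin{bmatrix}0&0\\0&C^TDD_\xi^{-1}B^T\end{bmatrix},\ N_{-1}=\begin{bmatrix}-BD_\xi^{-1}D^TC&0\\0&0\end{bmatrix},$$ $$H(\lambda,\xi)=\lambda I-M_0-\sum_{i=1}^m(M_ie^{-\lambda\tau_i}+M_{-i}e^{\lambda\tau_i})-(N_1e^{-\lambda\tau_0}+N_{-1}e^{\lambda\tau_0}).$$ Let $X=\mathcal{C}([-1,1],\mathbb{C}^{2n})$ be the space of continuous functions. The operator $\mathcal{L}_\xi$ on $X$ has domain $$\mathcal{D}(\mathcal{L}_\xi)=\Big\{\phi\in X:\ \phi'\in X,\ \phi'(0)=M_0\phi(0)+\sum_{i=1}^m(M_i\phi(-\tau_i)+M_{-i}\phi(\tau_i))+N_1\phi(-\tau_0)+N_{-1}\phi(\tau_0)\Big\}$$ and acts by $\mathcal{L}_\xi\phi=\phi'$.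 Writing $(\lambda I-\mathcal{L}_\xi)u=0$ includes $u\in\mathcal{D}(\mathcal{L}_\xi)$. *)

(* Defs.v *)
From HB Require Import structures.
From mathcomp Require Import all_boot all_order all_algebra.
From mathcomp Require Import all_classical all_reals all_analysis.
From mathcomp Require Import complex.

Set Implicit Arguments.
Unset Strict Implicit.
Unset Printing Implicit Defensive.

Import Order.TTheory GRing.Theory Num.Theory.
Import numFieldNormedType.Exports.

Local Open Scope classical_set_scope.
Local Open Scope ring_scope.
Local Open Scope complex_scope.

(* R[i] packed as a numClosedFieldType: this is what gives 'cV[cplx R]_k the
   topology of the complex modulus; the bare type R[i] does not carry it. *)
Definition cplx (R : realType) : numClosedFieldType := R[i].

Definition toC (R : realType) (x : R) : cplx R := x%:C.

Definition mxC (R : realType) (p q : nat) (M : 'M[R]_(p, q)) :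
  'M[cplx R]_(p, q) := map_mx (@toC R) M.

(* e^(a + ib) = e^a (cos b + i sin b); there is no complex exponential in the
   library. *)
Definition cexp (R : realType) (z : cplx R) : cplx R :=
  toC (expR (complex.Re z)) *
  ((cos (complex.Im z) +i* sin (complex.Im z)) : R[i]).

(* An element of C([-1,1], C^k) is represented by a function on R, of which
   only the restriction to [-1,1] is ever used: all (in)equalities between
   such functions are tested on [-1,1] only. *)
Section ContinuousFunctions.
Context {R : realType} {k : nat}.
Implicit Types u phi : R -> 'cV[cplx R]_k.

Definition inX u : Prop := {within `[-1, 1], continuous u}.

Definition eqX u phi : Prop := {in `[-1, 1], forall theta, u theta = phi theta}.

(* The punctured neighbourhoods of t are cut down to [-1,1], so the derivative
   is one-sided at the endpoints. *)
Definition diffquot phi (t : R) : R -> 'cV[cplx R]_k :=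
  fun s => toC (s - t)^-1 *: (phi s - phi t).

Definition derivable_on_X phi : Prop :=
  {in `[-1, 1], forall t, cvg (diffquot phi t @ within `[-1, 1] t^')}.

Definition deriv_on_X phi : R -> 'cV[cplx R]_k :=
  fun t => lim (diffquot phi t @ within `[-1, 1] t^').

End ContinuousFunctions.

(* The index i of A and tau runs over 0, ..., m; the conditions 1 <= i in the
   sums below single out the indices 1, ..., m. *)
Section System.
Context {R : realType} {n nu ny m : nat}.
Variables (A : 'I_m.+1 -> 'M[R]_n) (B : 'M[R]_(n, nu)) (C : 'M[R]_(ny, n))
  (D : 'M[R]_(ny, nu)) (tau : 'I_m.+1 -> R) (xi : R).

Definition Dxi : 'M[R]_nu := D^T *m D - (xi ^+ 2)%:M.

Definition M0 : 'M[R]_(n + n) :=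
  block_mx (A ord0) (- (B *m invmx Dxi *m B^T))
           (- (C^T *m C) + C^T *m D *m invmx Dxi *m D^T *m C) (- (A ord0)^T).

Definition Mpos (i : 'I_m.+1) : 'M[R]_(n + n) := block_mx (A i) 0 0 0.

Definition Mneg (i : 'I_m.+1) : 'M[R]_(n + n) := block_mx 0 0 0 (- (A i)^T).

Definition Npos : 'M[R]_(n + n) :=
  block_mx 0 0 0 (C^T *m D *m invmx Dxi *m B^T).

Definition Nneg : 'M[R]_(n + n) :=
  block_mx (- (B *m invmx Dxi *m D^T *m C)) 0 0 0.

Definition Hmx (lambda : cplx R) : 'M[cplx R]_(n + n) :=
  lambda%:M - mxC M0
  - \sum_(i < m.+1 | (1 <= i)%N)
      (cexp (- lambda * toC (tau i)) *: mxC (Mpos i)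
       + cexp (lambda * toC (tau i)) *: mxC (Mneg i))
  - (cexp (- lambda * toC (tau ord0)) *: mxC Npos
     + cexp (lambda * toC (tau ord0)) *: mxC Nneg).

Definition domL (phi : R -> 'cV[cplx R]_(n + n)) : Prop :=
  [/\ inX phi, derivable_on_X phi, inX (deriv_on_X phi) &
      deriv_on_X phi 0 =
        mxC M0 *m phi 0
        + \sum_(i < m.+1 | (1 <= i)%N)
            (mxC (Mpos i) *m phi (- tau i) + mxC (Mneg i) *m phi (tau i))
        + mxC Npos *m phi (- tau ord0) + mxC Nneg *m phi (tau ord0)].

Definition opL (phi : R -> 'cV[cplx R]_(n + n)) : R -> 'cV[cplx R]_(n + n) :=
  deriv_on_X phi.

(* (lambda I - L_xi) u = 0 in X, including u \in D(L_xi) *)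
Definition kerL (lambda : cplx R) (u : R -> 'cV[cplx R]_(n + n)) : Prop :=
  domL u /\ eqX (fun theta => lambda *: u theta - opL u theta) (fun=> 0).

End System.

(* Main.v *)
(** Off the endpoints, an entry of a solution of [lambda u = u'] is a complex
    scalar whose real and imaginary parts solve the planar system
    [a' = p a - q b, b' = q a + p b], where [lambda = p + i q].  Rotating by
    [- q t] and scaling by [e^(- p t)] gives functions with zero derivative,
    which the mean value theorem makes constant on [-1,1]; hence
    [u(t) = e^(lambda t) u(0)].  For such a [u] the boundary condition defining
    the domain of the operator reads [H(lambda, xi) u(0) = 0]. *)

Require Import Defs.
From HB Require Import structures.
From mathcomp Require Import all_boot all_order all_algebra.
From mathcomp Require Import all_classical all_reals all_analysis.
From mathcomp Require Import complex ring lra.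
Import Order.TTheory GRing.Theory Num.Theory.
Import numFieldNormedType.Exports.
Local Open Scope classical_set_scope.
Local Open Scope ring_scope.

(** * Real calculus on a segment and the planar linear system *)

(** The substitution [s = t + h] carries the punctured filter at [t] to the one at [0]. This links
    quotients in the style of [diffquot] to [is_derive]. *)
Lemma cvg_slopeE {R : realType} (f : R -> R) (t l : R) :
  (s - t)^-1 * (f s - f t) @[s --> t^'] --> l <-> is_derive t 1 f l.
Proof.
have -> : (s - t)^-1 * (f s - f t) @[s --> t^'] =
    (h^-1 *: ((f \o shift t) (h *: 1) - f t) @[h --> 0^']).
  rewrite funeqE => P; rewrite propeqE /fmap /= /dnbhs /within /=.
  rewrite [X in X <-> _](near_shift 0 t).
  have E h : (((h + (t - 0))%R : R) != t) = (h != 0).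
    by rewrite subr0 -subr_eq0 addrK.
  split; apply: (@filterS _ (nbhs (0 : R))) => h /=;
    by rewrite E subr0 addrK /GRing.scale /= mulr1.
split=> [fl|[df <-]]; last exact: df.
split; first by apply/cvg_ex; exists l.
exact: (cvg_lim (@norm_hausdorff _ _)).
Qed.

(** The segment accumulates at [t] from the right if [t < b], and from the left otherwise.
    Properness makes limits unique, so that the [lim] in [deriv_on_X] can be computed even at the
    endpoints. *)
Lemma within_itv_dnbhs_proper {R : realType} (a b t : R) :
  a < b -> t \in `[a, b] -> ProperFilter (within `[a, b] t^').
Proof.
move=> ab; rewrite in_itv /= => /andP[at_ tb].
apply: Build_ProperFilter_ex => P nP; have [tb'|bt] := ltP t b.
  have nP' : t^'+ (fun s => s != t -> s \in `[a, b] -> P s).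
    by apply: (@filterS _ (nbhs t)) nP => s Ps _.
  apply: (@filter_ex _ t^'+).
  apply: filterS3 nP' (nbhs_right_gt t) (nbhs_right_lt tb') => s + ts sb.
  by apply; rewrite ?gt_eqF // in_itv /= (le_trans at_) ltW.
have at' : a < t by exact: lt_le_trans bt.
have nP' : t^'- (fun s => s != t -> s \in `[a, b] -> P s).
  by apply: (@filterS _ (nbhs t)) nP => s Ps _.
apply: (@filter_ex _ t^'-).
apply: filterS3 nP' (nbhs_left_gt at') (nbhs_left_lt t) => s + as_ st.
by apply; rewrite ?lt_eqF // in_itv /= (ltW as_) (le_trans (ltW st)).
Qed.

Lemma eq_left_endpoint_of_derive0 {R : realType} (a b : R) (f : R -> R) :
  {within `[a, b], continuous f} ->
  {in `]a, b[, forall t, is_derive (t : R) 1 f 0} ->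
  {in `[a, b], forall t, f t = f a}.
Proof.
move=> fcont f0 t; rewrite in_itv /= => /andP[at_ tb].
have [s _ /eqP] : exists2 s, s \in `[a, t] & f t - f a = 0 * (t - a).
  apply: (MVT_segment at_).
    move=> s; rewrite in_itv /= => /andP[as_ st]; apply: f0.
    by rewrite in_itv /= as_ (lt_le_trans st).
  apply: continuous_subspaceW fcont => s /=; rewrite !in_itv /= => /andP[-> st].
  exact: le_trans st tb.
by rewrite mul0r subr_eq0 => /eqP.
Qed.

Lemma is_derive_comp_scale {R : realType} (f : R -> R) (c t df : R) :
  is_derive (c * t) 1 f df -> is_derive t 1 (fun s => f (c * s)) (c * df).
Proof.
move=> fdf; rewrite mulrC; apply: is_derive1_comp fdf _.
by apply: is_derive_eq; rewrite /GRing.scale /= mulr1.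
Qed.

Lemma planar_linear_ode {R : realType} (p q l r : R) (a b : R -> R) :
  0 \in `[l, r] ->
  {within `[l, r], continuous a} -> {within `[l, r], continuous b} ->
  {in `]l, r[, forall t : R, is_derive t 1 a (p * a t - q * b t)} ->
  {in `]l, r[, forall t : R, is_derive t 1 b (q * a t + p * b t)} ->
  {in `[l, r], forall t,
    a t = expR (p * t) * (cos (q * t) * a 0 - sin (q * t) * b 0) /\
    b t = expR (p * t) * (sin (q * t) * a 0 + cos (q * t) * b 0)}.
Proof.
move=> lr0 acont bcont da db t tlr.
have dexp (s : R) :
    is_derive s 1 (fun x => expR (- p * x)) (- p * expR (- p * s)).
  exact: is_derive_comp_scale (is_derive_expR _).
have dcos (s : R) :
    is_derive s 1 (fun x => cos (q * x)) (q * - sin (q * s)).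
  exact: is_derive_comp_scale (is_derive_cos _).
have dsin (s : R) : is_derive s 1 (fun x => sin (q * x)) (q * cos (q * s)).
  exact: is_derive_comp_scale (is_derive_sin _).
(* [wr] and [wi] are the real and imaginary parts of [e^(-(p + iq)s) (a + ib)]. *)
pose wr s := expR (- p * s) * (cos (q * s) * a s + sin (q * s) * b s).
pose wi s := expR (- p * s) * (cos (q * s) * b s - sin (q * s) * a s).
have ccont (f df : R -> R) : (forall s : R, is_derive s 1 f (df s)) ->
    {within `[l, r], continuous f}.
  by move=> fdf; apply: derivable_within_continuous => s _; exact: ex_derive.
have [ce cc cs] := And3 (ccont _ _ dexp) (ccont _ _ dcos) (ccont _ _ dsin).
have wr0 : {in `[l, r], forall s, wr s = wr l}.
  apply: eq_left_endpoint_of_derive0 => [s|s lrs].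
    exact: cvgM (ce s) (cvgD (cvgM (cc s) (acont s)) (cvgM (cs s) (bcont s))).
  have [? ?] := (da s lrs, db s lrs).
  by apply: is_derive_eq; rewrite /GRing.scale /=; ring.
have wi0 : {in `[l, r], forall s, wi s = wi l}.
  apply: eq_left_endpoint_of_derive0 => [s|s lrs].
    exact: cvgM (ce s) (cvgB (cvgM (cc s) (bcont s)) (cvgM (cs s) (acont s))).
  have [? ?] := (da s lrs, db s lrs).
  by apply: is_derive_eq; rewrite /GRing.scale /=; ring.
(* Comparing the constants at [0] and at [t] expresses [a 0] and [b 0] through [a t] and [b t]; the
   rotation and the scaling are then inverted. *)
have := wr0 0 lr0; rewrite -(wr0 t tlr) /wr.
have := wi0 0 lr0; rewrite -(wi0 t tlr) /wi.
rewrite !mulr0 cos0 sin0 expR0 !mul1r !mul0r addr0 subr0 => -> ->.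
rewrite mulNr expRN.
have e0 : expR (p * t) != 0 by rewrite gt_eqF // expR_gt0.
have cs1 := cos2Dsin2 (q * t).
(* Rotating forth and back leaves a factor [cos^2 + sin^2], so the same factor is inserted on the
   left. *)
by split; rewrite -[LHS]mul1r -cs1; field; exact: e0.
Qed.

(** * Complex scalars and the exponential in real coordinates *)

Lemma toC_continuous {R : realType} : continuous (@toC R).
Proof.
(* A positive complex number has zero imaginary part, so the radius is a positive real. *)
move=> x; apply/cvgrPdist_lt => -[e e'] /=; rewrite ltcE /= => /andP[/eqP-> e0].
near=> y; have xy : `|x - y| < e by near: y; exact: cvgr_dist_lt.
rewrite -[_ - _]/((x%:C - y%:C)%C) -rmorphB /=.
by rewrite normc_def /= expr0n addr0 sqrtr_sqr ltcR.
Unshelve. all: by end_near. Qed.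

Lemma ReB {R : realType} (z w : cplx R) :
  complex.Re (z - w) = complex.Re z - complex.Re w.
Proof. by case: z w => [? ?] [? ?]. Qed.

Lemma ImB {R : realType} (z w : cplx R) :
  complex.Im (z - w) = complex.Im z - complex.Im w.
Proof. by case: z w => [? ?] [? ?]. Qed.

(** The real part is 1-Lipschitz, being bounded by the modulus. *)
Lemma Re_continuous {R : realType} : continuous (@complex.Re R : cplx R -> R).
Proof.
move=> x; apply/(@cvgrPdist_lt _ _ _ (nbhs (x : cplx R))) => e e0.
near=> y; have xy : `|x - y| < toC e.
  near: y; apply: (@cvgr_dist_lt _ (cplx R) _ (nbhs x) _ id x) => //.
  by rewrite ltcR.
rewrite -ltcR; apply: le_lt_trans xy.
by rewrite -ReB normc_ge_Re.
Unshelve. all: by end_near. Qed.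

(** Reduces to the real part through [Im z = - Re (z i)]. *)
Lemma Im_continuous {R : realType} : continuous (@complex.Im R : cplx R -> R).
Proof.
have -> : @complex.Im R = (fun x : cplx R => - complex.Re (x * 'i%C)).
  by apply/funext => x; rewrite ReiNIm opprK.
move=> x; apply: (@cvgN _ R _ (nbhs (x : cplx R))).
apply: (@cvg_comp (cplx R) _ _ (fun y => y * 'i%C) _ _ (nbhs (x * 'i%C))).
  exact: (@cvgMr_tmp _ _ (nbhs (x : cplx R))).
exact: Re_continuous.
Qed.

Lemma ReM {R : realType} (z w : cplx R) :
  complex.Re (z * w) =
  complex.Re z * complex.Re w - complex.Im z * complex.Im w.
Proof. by case: z w => [? ?] [? ?]. Qed.

Lemma ImM {R : realType} (z w : cplx R) :
  complex.Im (z * w) =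
  complex.Re z * complex.Im w + complex.Im z * complex.Re w.
Proof. by case: z w => [? ?] [? ?]. Qed.

Lemma cexpE {R : realType} (z : cplx R) (t : R) :
  cexp (z * toC t) =
  Complex (expR (complex.Re z * t) * cos (complex.Im z * t))
          (expR (complex.Re z * t) * sin (complex.Im z * t)).
Proof.
case: z => p q.
have -> : Complex p q * toC t = Complex (p * t) (q * t) :> cplx R.
  apply/eqP; rewrite eq_complex /=.
  by apply/andP; split; apply/eqP; ring.
apply/eqP; rewrite eq_complex /=.
by apply/andP; split; apply/eqP; ring.
Qed.

Lemma cexp0 {R : realType} (z : cplx R) : cexp (z * toC 0) = 1.
Proof. by rewrite cexpE !mulr0 expR0 cos0 sin0 mulr1 mulr0. Qed.

(** * Eigenfunctions are exponentials *)

(** Near an interior point, cutting neighbourhoods down to the segment changes nothing. *)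
Lemma diffquot_cvg_dnbhs {R : realType} {k : nat} (u : R -> 'cV[cplx R]_k)
    (t : R) (l : 'cV[cplx R]_k) :
  t \in `]-1, 1[ ->
  diffquot u t @ within `[-1, 1] t^' --> l -> diffquot u t @ t^' --> l.
Proof.
move=> t11 ul; apply: cvg_trans ul => P; rewrite /fmap /within /= => nP.
apply: (@filterS2 _ (nbhs t)) (near_in_itvoo t11) nP => s s11 + st; apply => //.
exact: subset_itv_oo_cc.
Qed.

(** The factor [toC (s - t)^-1] is real, so taking real parts commutes with forming the quotient. *)
Lemma is_derive_Re {R : realType} {k : nat} (u : R -> 'cV[cplx R]_k)
    (t : R) (l : 'cV[cplx R]_k) (j : 'I_k) :
  diffquot u t @ t^' --> l ->
  is_derive t 1 (fun s => complex.Re (u s j 0)) (complex.Re (l j 0)).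
Proof.
move=> ul; apply/cvg_slopeE.
have := cvg_comp _ _ (cvg_comp _ _ ul (@coord_continuous _ _ _ j 0 l))
  (Re_continuous _).
apply: cvg_trans; apply: near_eq_cvg; near=> s.
rewrite /= /diffquot !mxE ReM ReB /= mul0r subr0.
Unshelve. all: by end_near. Qed.

Lemma is_derive_Im {R : realType} {k : nat} (u : R -> 'cV[cplx R]_k)
    (t : R) (l : 'cV[cplx R]_k) (j : 'I_k) :
  diffquot u t @ t^' --> l ->
  is_derive t 1 (fun s => complex.Im (u s j 0)) (complex.Im (l j 0)).
Proof.
move=> ul; apply/cvg_slopeE.
have := cvg_comp _ _ (cvg_comp _ _ ul (@coord_continuous _ _ _ j 0 l))
  (Im_continuous _).
apply: cvg_trans; apply: near_eq_cvg; near=> s.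
rewrite /= /diffquot !mxE ImM ImB /= mul0r addr0.
Unshelve. all: by end_near. Qed.

Lemma zero_in_itvN11 {R : realType} : 0 \in `[-1, 1 : R].
Proof. by rewrite in_itv /= lerN10 ler01. Qed.

(** The differential equation is used only at interior points; continuity on the closed segment
    carries the formula to the endpoints. *)
Lemma deriv_on_X_eigen {R : realType} {k : nat} (lambda : cplx R)
    (u : R -> 'cV[cplx R]_k) :
  inX u -> derivable_on_X u ->
  eqX (fun t => lambda *: u t - deriv_on_X u t) (fun=> 0) ->
  eqX u (fun t => cexp (lambda * toC t) *: u 0).
Proof.
move=> ucont du ueigen t t11; apply/matrixP => j j0; rewrite ord1 {j0}.
have dut s : s \in `]-1, 1[ -> diffquot u s @ s^' --> lambda *: u s.
  move=> s11; have s11' := subset_itv_oo_cc s11.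
  have <- : deriv_on_X u s = lambda *: u s.
    by apply/esym/eqP; rewrite -subr_eq0; apply/eqP/ueigen.
  exact: diffquot_cvg_dnbhs (du _ s11').
have coordcont (f : cplx R -> R) : continuous f ->
    {within `[-1, 1], continuous (fun s => f (u s j 0))}.
  move=> fcont s; apply: (@cvg_comp _ _ _ u (fun M => f (M j 0))) (ucont s) _.
  apply: (@cvg_comp _ _ _ (fun M : 'cV_k => M j 0) f _ (nbhs (u s j 0))).
    exact: coord_continuous.
  exact: fcont.
have [] := @planar_linear_ode R (complex.Re lambda) (complex.Im lambda) (-1) 1
  (fun s => complex.Re (u s j 0)) (fun s => complex.Im (u s j 0)) zero_in_itvN11
  (coordcont _ Re_continuous) (coordcont _ Im_continuous) _ _ t t11.
- move=> s s11; apply: is_derive_eq (is_derive_Re _ _ _ _ (dut _ s11)) _.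
  by rewrite mxE ReM.
- move=> s s11; apply: is_derive_eq (is_derive_Im _ _ _ _ (dut _ s11)) _.
  by rewrite mxE ImM addrC.
move=> Re_u Im_u; rewrite mxE cexpE.
apply/eqP; rewrite eq_complex Re_u Im_u /=.
by apply/andP; split; apply/eqP; case: (u 0 j 0) => [x y] /=; ring.
Qed.

(** * Differentiation and continuity of vector exponentials *)

(** The coordinates [x], [y] of the exponential solve the planar system, and [x' + i y'] regroups as
    [(p + iq)(x + iy)]. *)
Lemma diffquot_cexp_cvg {R : realType} {k : nat} (lambda : cplx R)
    (v : 'cV[cplx R]_k) (t : R) :
  diffquot (fun s => cexp (lambda * toC s) *: v) t @ t^' -->
  lambda *: (cexp (lambda * toC t) *: v).
Proof.
case: lambda => p q; set e := fun s : R => expR (p * s).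
pose x s := e s * cos (q * s); pose y s := e s * sin (q * s).
have de : is_derive t 1 e (p * e t).
  exact: is_derive_comp_scale (is_derive_expR _).
have dc : is_derive t 1 (fun s => cos (q * s)) (q * - sin (q * t)).
  exact: is_derive_comp_scale (is_derive_cos _).
have ds : is_derive t 1 (fun s => sin (q * s)) (q * cos (q * t)).
  exact: is_derive_comp_scale (is_derive_sin _).
have dx : is_derive t 1 x (p * x t - q * y t).
  by apply: is_derive_eq; rewrite /GRing.scale /x /y /=; ring.
have dy : is_derive t 1 y (q * x t + p * y t).
  by apply: is_derive_eq; rewrite /GRing.scale /x /y /=; ring.
have cx := cvg_comp _ _ (iffRL (cvg_slopeE _ _ _) dx) (toC_continuous _).
have cy := cvg_comp _ _ (iffRL (cvg_slopeE _ _ _) dy) (toC_continuous _).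
have ixy : toC ((s - t)^-1 * (x s - x t)) +
    'i%C * toC ((s - t)^-1 * (y s - y t)) @[s --> t^'] -->
    toC (p * x t - q * y t) + ('i%C : cplx R) * toC (q * x t + p * y t).
  exact: cvgD cx (@cvgMl_tmp _ _ _ _ _ 'i%C _ cy).
rewrite scalerA.
have -> : ((p +i* q)%C : cplx R) * cexp ((p +i* q)%C * toC t) =
   toC (p * x t - q * y t) + ('i%C : cplx R) * toC (q * x t + p * y t).
  rewrite cexpE; apply/eqP; rewrite eq_complex /=.
  by apply/andP; split; apply/eqP; rewrite /x /y /e; ring.
have -> : diffquot (fun s => cexp ((p +i* q)%C * toC s) *: v) t =
    fun s => (toC ((s - t)^-1 * (x s - x t)) +
    'i%C * toC ((s - t)^-1 * (y s - y t))) *: v.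
  apply/funext => s; rewrite /diffquot -scalerBl scalerA /= !cexpE.
  congr (_ *: _); apply/eqP; rewrite eq_complex /=.
  by apply/andP; split; apply/eqP; rewrite /x /y /e; ring.
exact: cvgZr_tmp ixy.
Qed.

Lemma cexp_scale_continuous {R : realType} {k : nat} (lambda : cplx R)
    (v : 'cV[cplx R]_k) :
  continuous (fun t : R => cexp (lambda * toC t) *: v).
Proof.
case: lambda => p q.
pose x t : R := expR (p * t) * cos (q * t).
pose y t : R := expR (p * t) * sin (q * t).
have clin (c : R) : continuous (fun t : R => c * t).
  by move=> t; exact: cvgMl_tmp.
have clin_comp (f : R -> R) (c : R) :
    continuous f -> continuous (fun t : R => f (c * t)).
  move=> fcont t; apply: (@continuous_comp R R R ( *%R c) f t).
    exact: clin.
  exact: fcont.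
have ce := clin_comp _ p (@continuous_expR R).
have cx : continuous x.
  by move=> t; exact: cvgM (ce t) (clin_comp _ q (@continuous_cos R) t).
have cy : continuous y.
  by move=> t; exact: cvgM (ce t) (clin_comp _ q (@continuous_sin R) t).
have -> : (fun t => cexp ((p +i* q)%C * toC t) *: v) =
    fun t => (toC (x t) + 'i%C * toC (y t)) *: v.
  apply/funext => t; rewrite cexpE; congr (_ *: _).
  by apply/eqP; rewrite eq_complex /=; apply/andP; split; apply/eqP;
    rewrite /x /y; ring.
move=> t.
have cxC : toC (x s) @[s --> t] --> toC (x t).
  exact: cvg_comp (cx t) (@toC_continuous R _).
have cyC : toC (y s) @[s --> t] --> toC (y t).
  exact: cvg_comp (cy t) (@toC_continuous R _).
have cxy : toC (x s) + 'i%C * toC (y s) @[s --> t] -->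
    toC (x t) + ('i%C : cplx R) * toC (y t).
  exact: cvgD cxC (@cvgMl_tmp _ _ _ _ _ 'i%C _ cyC).
exact: cvgZr_tmp cxy.
Qed.

Lemma deriv_on_X_cexp {R : realType} {k : nat} (lambda : cplx R)
    (v : 'cV[cplx R]_k) (t : R) : t \in `[-1, 1] ->
  deriv_on_X (fun s => cexp (lambda * toC s) *: v) t =
  lambda *: (cexp (lambda * toC t) *: v).
Proof.
(* With a proper filter the limit is unique, and the two-sided limit restricts to the segment, hence
   to one side at an endpoint. *)
move=> t11; have ? : ProperFilter (within `[-1, 1] t^').
  by apply: within_itv_dnbhs_proper => //; rewrite ltrNl gtrN.
apply: (cvg_lim (@norm_hausdorff _ _)).
exact: cvg_trans (cvg_app _ (cvg_within _)) (diffquot_cexp_cvg _ _ _).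
Qed.

(** * The boundary condition and the characteristic matrix *)

(** Scalars move from the vectors onto the matrices, where they assemble the shape of [Hmx].
    Abstract coefficients keep the blocks and exponentials out of the computation. *)
Lemma mulmx_delay_sum {K : comNzRingType} {k : nat} {I : finType} (p : pred I)
    (M N N' : 'M[K]_k) (P Q : I -> 'M[K]_k) (a b : I -> K) (c d l : K)
    (v : 'cV[K]_k) :
  M *m v + \sum_(i | p i) (P i *m (a i *: v) + Q i *m (b i *: v))
  + N *m (c *: v) + N' *m (d *: v)
  = l *: v - (l%:M - M - \sum_(i | p i) (a i *: P i + b i *: Q i)
              - (c *: N + d *: N')) *m v.
Proof.
rewrite !mulmxBl mul_scalar_mx mulmx_suml mulmxDl -!scalemxAl -!scalemxAr.
rewrite -!addrA -!opprD opprB [RHS]addrC subrK; congr (_ + (_ + _)).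
by apply: eq_bigr => i _; rewrite mulmxDl -!scalemxAl -!scalemxAr.
Qed.

(** Since an exponential has derivative [lambda *: v] at [0], this turns the boundary condition in
    [domL] into [H v = 0]; both directions of the equivalence rest on it. *)
Lemma delay_term_cexp {R : realType} {n nu ny m : nat}
    (A : 'I_m.+1 -> 'M[R]_n) (B : 'M[R]_(n, nu)) (C : 'M[R]_(ny, n))
    (D : 'M[R]_(ny, nu)) (tau : 'I_m.+1 -> R) (xi : R) (lambda : cplx R)
    (v : 'cV[cplx R]_(n + n)) (u : R -> 'cV[cplx R]_(n + n)) :
  (forall i, tau i \in `[0, 1]) ->
  eqX u (fun t => cexp (lambda * toC t) *: v) ->
  mxC (M0 A B C D xi) *m u 0
  + \sum_(i < m.+1 | (1 <= i)%N)
      (mxC (Mpos A i) *m u (- tau i) + mxC (Mneg A i) *m u (tau i))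
  + mxC (Npos B C D xi) *m u (- tau ord0)
  + mxC (Nneg B C D xi) *m u (tau ord0)
  = lambda *: v - Hmx A B C D tau xi lambda *m v.
Proof.
move=> tau01 uE.
(* The form of [u] is known only on the segment, so every delayed and advanced argument must lie
   there. *)
have tau11 i : (tau i \in `[-1, 1]) /\ (- tau i \in `[-1, 1]).
  have := tau01 i; rewrite !in_itv /= => /andP[t0 t1].
  by split; apply/andP; split; lra.
have u0 : u 0 = v by rewrite uE ?zero_in_itvN11 // cexp0 scale1r.
have uN i : u (- tau i) = cexp (- lambda * toC (tau i)) *: v.
  have [_ tN] := tau11 i.
  rewrite uE // mulNr -mulrN; congr (cexp (_ * _) *: _).
  by apply/eqP; rewrite eq_complex /= oppr0 !eqxx.
have up i : u (tau i) = cexp (lambda * toC (tau i)) *: v.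
  by have [tP _] := tau11 i; rewrite uE.
rewrite u0 uN up; under eq_bigr do rewrite uN up.
exact: mulmx_delay_sum.
Qed.

Lemma kerL_cexp {R : realType} {n nu ny m : nat}
    (A : 'I_m.+1 -> 'M[R]_n) (B : 'M[R]_(n, nu)) (C : 'M[R]_(ny, n))
    (D : 'M[R]_(ny, nu)) (tau : 'I_m.+1 -> R) (xi : R) (lambda : cplx R)
    (v : 'cV[cplx R]_(n + n)) :
  (forall i, tau i \in `[0, 1]) -> Hmx A B C D tau xi lambda *m v = 0 ->
  kerL A B C D tau xi lambda (fun t => cexp (lambda * toC t) *: v).
Proof.
move=> tau01 Hv.
split; last by move=> t t11; rewrite /opL deriv_on_X_cexp ?subrr.
split.
- exact: continuous_subspaceT (cexp_scale_continuous _ _).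
- move=> t t11; apply/cvg_ex; exists (lambda *: (cexp (lambda * toC t) *: v)).
  exact: cvg_trans (cvg_app _ (cvg_within _)) (diffquot_cexp_cvg _ _ _).
(* The derivative is identified only on the segment, so continuity is transferred from a globally
   continuous function agreeing with it there. *)
- apply: (@subspace_eq_continuous _ _ _
    (fun t => lambda *: (cexp (lambda * toC t) *: v))).
    by move=> t /set_mem t11; exact/esym/deriv_on_X_cexp.
  apply: continuous_subspaceT => t.
  exact: cvgZl_tmp (cexp_scale_continuous _ _ _).
- rewrite deriv_on_X_cexp ?zero_in_itvN11 // cexp0 scale1r.
  have := @delay_term_cexp _ _ _ _ _ A B C D tau xi lambda v
    (fun t => cexp (lambda * toC t) *: v) tau01 (fun _ _ => erefl).
  by rewrite Hv subr0 cexp0 scale1r => ->.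
Qed.

Lemma kerL_eigenvector {R : realType} {n nu ny m : nat}
    (A : 'I_m.+1 -> 'M[R]_n) (B : 'M[R]_(n, nu)) (C : 'M[R]_(ny, n))
    (D : 'M[R]_(ny, nu)) (tau : 'I_m.+1 -> R) (xi : R) (lambda : cplx R)
    (u : R -> 'cV[cplx R]_(n + n)) :
  (forall i, tau i \in `[0, 1]) -> kerL A B C D tau xi lambda u ->
  Hmx A B C D tau xi lambda *m u 0 = 0 /\
  eqX u (fun t => cexp (lambda * toC t) *: u 0).
Proof.
move=> tau01 [[ucont du _ u0] ueigen].
have uE := deriv_on_X_eigen _ _ ucont du ueigen.
split=> //; move: u0; rewrite (delay_term_cexp _ _ _ _ _ _ _ _ _ tau01 uE).
(* The eigenvalue equation at [0] gives [u'(0) = lambda u(0)]; the boundary condition gives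
   [u'(0) = lambda u(0) - H u(0)]. *)
have /eqP : lambda *: u 0 - deriv_on_X u 0 = 0.
  by apply: ueigen; exact: zero_in_itvN11.
rewrite subr_eq0 => /eqP -> /eqP; rewrite eq_sym subr_eq -subr_eq0 opprD addrA.
by rewrite subrr sub0r oppr_eq0 => /eqP.
Qed.

Theorem proposition2p2 (R : realType) (n nu ny m : nat)
    (A : 'I_m.+1 -> 'M[R]_n) (B : 'M[R]_(n, nu)) (C : 'M[R]_(ny, n))
    (D : 'M[R]_(ny, nu)) (tau : 'I_m.+1 -> R)
    (tau_ge0 : forall i, 0 <= tau i)
    (tau_max : \big[Num.max/0]_(i < m.+1) tau i = 1)
    (xi : R) (xi_gt0 : 0 < xi) (Dxi_unit : Dxi D xi \in unitmx)
    (lambda : cplx R) :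
  [/\ (exists v : 'cV[cplx R]_(n + n),
         v <> 0 /\ Hmx A B C D tau xi lambda *m v = 0)
      <->
      (exists u : R -> 'cV[cplx R]_(n + n),
         [/\ inX u, ~ eqX u (fun=> 0) & kerL A B C D tau xi lambda u]),
      (forall u : R -> 'cV[cplx R]_(n + n),
         inX u -> ~ eqX u (fun=> 0) -> kerL A B C D tau xi lambda u ->
         exists v : 'cV[cplx R]_(n + n),
           [/\ v <> 0, Hmx A B C D tau xi lambda *m v = 0 &
               eqX u (fun theta => cexp (lambda * toC theta) *: v)]) &
      (forall v : 'cV[cplx R]_(n + n),
         v <> 0 -> Hmx A B C D tau xi lambda *m v = 0 ->
         let u := fun theta : R => cexp (lambda * toC theta) *: v in
         [/\ inX u, ~ eqX u (fun=> 0) & kerL A B C D tau xi lambda u])].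
Proof.
have tau01 i : tau i \in `[0, 1].
  by rewrite in_itv /= tau_ge0 -tau_max; exact: (le_bigmax _ tau i).
have H_of_L (u : R -> 'cV[cplx R]_(n + n)) :
    ~ eqX u (fun=> 0) -> kerL A B C D tau xi lambda u ->
    exists v : 'cV[cplx R]_(n + n),
      [/\ v <> 0, Hmx A B C D tau xi lambda *m v = 0 &
          eqX u (fun theta => cexp (lambda * toC theta) *: v)].
  move=> u_neq0 /(kerL_eigenvector _ _ _ _ _ _ _ _ tau01)[Hu0 uE].
  (* If [u 0] vanished, the exponential form would make [u] zero on the whole segment. *)
  exists (u 0); split=> // u0; apply: u_neq0 => t t11.
  by rewrite uE // u0 scaler0.
have L_of_H (v : 'cV[cplx R]_(n + n)) :
    v <> 0 -> Hmx A B C D tau xi lambda *m v = 0 ->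
    let u := fun theta : R => cexp (lambda * toC theta) *: v in
    [/\ inX u, ~ eqX u (fun=> 0) & kerL A B C D tau xi lambda u].
  move=> v_neq0 Hv u; split; last exact: kerL_cexp.
    exact: continuous_subspaceT (cexp_scale_continuous _ _).
  (* Evaluation at [0], where the exponential is [1], recovers [v]. *)
  by move=> /(_ 0 zero_in_itvN11); rewrite /u cexp0 scale1r.
split=> [|u _ |//]; last exact: H_of_L.
split=> [[v [v_neq0 Hv]]|[u [_ u_neq0 /(H_of_L _ u_neq0)[v []]]]].
  by exists (fun theta => cexp (lambda * toC theta) *: v); exact: L_of_H.
by exists v.
Qed.
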